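(* Let $c\ge 3$ and let $w\in W_c$ be a reduced billiard table word. The reduced billiard table diagram $\widetilde D$ of $w$ corresponds to a unique alternating diagram $D$: converting each run of $w$ into a single crossing by the rule $$(+)^1\mapsto\sigma_1,\qquad (+)^2\mapsto\sigma_2^{-1},\qquad (-)^1\mapsto\sigma_2^{-1},\qquad (-)^2\mapsto\sigma_1$$ simplifies $\widetilde D$ to a uniquely determined diagram $D$ of the same knot, and $D$ is alternating.
   Context: Words. For $c\ge 3$, $W_c$ is the set of reduced billiard table words $w=(+)^{\varepsilon_1}(-)^{\varepsilon_2}(+)^{\varepsilon_3}(-)^{\varepsilon_4}\cdots$ in the alphabet $\{+,-\}$ consisting of exactly $c$ runs of alternating sign, starting with a $+$ run (so the last run is $(+)^{\varepsilon_c}$ for $c$ odd and $(-)^{\varepsilon_c}$ for $c$ even), with $\varepsilon_1=\varepsilon_c=1$, $\varepsilon_i\in\{1,2\}$ for $2\le i\le c-1$, and length $\ell=\sum_{i=1}^c\varepsilon_i\equiv 1\bmod 3$. Braid conventions. Three-strand braids are drawn left to right with strands at heights $1,2,3$ (bottom to top); $\sigma_i^{\pm1}$ is a crossing between heights $i$ and $i+1$ whose overstrand has slope $\pm1$. Reduced billiard table diagram $\widetilde D$. For $w$ of length $\ell$, it is the long knot diagram whose $j$-th crossing ($1\le j\le\ell$) is $\sigma_1^{\pm1}$ for $j$ odd and $\sigma_2^{\pm1}$ for $j$ even, the exponent being $+1$ or $-1$ according to whether the $j$-th letter of $w$ is $+$ or $-$. On the left, strand 1 is the left end and strands 2, 3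 are joined by a cap. On the right, if $\ell$ is odd, strands 2, 3 are joined and strand 1 is the right end; if $\ell$ is even, strands 1, 2 are joined and strand 3 is the right end. Diagram $D$. It is the long knot diagram of the 3-strand braid word with $c$ letters obtained by the run-by-run conversion from left to right. On the left, strand 1 is the left end and strands 2, 3 are joined by a cap. On the right, if $c$ is odd, strands 2, 3 are joined and strand 1 is the right end; if $c$ is even, strands 1, 2 are joined and strand 3 is the right end. A long knot diagram is viewed as a knot diagram by closing it up in the usual way, joining its two ends by an arc without new crossings. *)

(* Defs.v *)
From Stdlib Require Import Relation_Operators.
From mathcomp Require Export all_boot.

Set Implicit Arguments.
Unset Strict Implicit.
Unset Printing Implicit Defensive.

(* A sign is a bool, true standing for + and false for -.                     *)
Definition sign := bool.

(* ** Sliced diagrams                                                         *)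
(* A tangle diagram in the plane, in general position with respect to the     *)
(* horizontal coordinate, is the left-to-right list of its elementary slices. *)
(* Between two slices the strands are numbered 0, 1, 2, ... from the bottom   *)
(* up.  A slice (k, p) leaves unchanged the strands other than those it acts  *)
(* on, which start at number p:                                               *)
(* - (X s, p) crosses the strands p and p+1, the overstrand having slope +1   *)
(*   if s is + and -1 if s is -;                                              *)
(* - (Cup, p) starts an arc, open to the right, whose ends are p and p+1;     *)
(* - (Cap, p) joins the strands p and p+1 by an arc open to the left.         *)
Inductive slice_kind := X of sign | Cup | Cap.
Definition slice := (slice_kind * nat)%type.
Definition diagram := seq slice.

Definition ins (k : slice_kind) : nat := if k is Cup then 0 else 2.
Definition outs (k : slice_kind) : nat := if k is Cap then 0 else 2.

(* D is a diagram with m ends on the left and n ends on the right.            *)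
Fixpoint tangle (m : nat) (D : diagram) (n : nat) : bool :=
  if D is (k, p) :: D' then
    (p + ins k <= m) && tangle (m - ins k + outs k) D' n
  else m == n.

Definition crossings (D : diagram) : nat :=
  count (fun x : slice => if x.1 is X _ then true else false) D.

(* The two ends of a long diagram (one end on each side) are joined by an arc *)
(* running below the diagram.                                                 *)
Definition close_up (D : diagram) : diagram :=
  (Cup, 0) :: [seq (x.1, x.2.+1) | x <- D] ++ [:: (Cap, 0)].

(* ** Travelling along a closed diagram                                       *)
(* The state (t, h, d) is the point of strand h lying between the slices t-1  *)
(* and t (slices being numbered from 0), together with a direction d of       *)
(* travel, true for rightwards and false for leftwards.                       *)
Definition state := (nat * nat * bool)%type.

Definition strands_at (D : diagram) (t : nat) : nat :=
  foldl (fun m (x : slice) => m - ins x.1 + outs x.1) 0 (take t D).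

Definition on_diagram (D : diagram) (a : state) : bool :=
  let: (t, h, _) := a in (t <= size D) && (h < strands_at D t).

Definition next_slice (D : diagram) (a : state) : slice :=
  let: (t, _, d) := a in nth (Cup, 0) D (if d then t else t.-1).

Definition swap (p h : nat) : nat :=
  if h == p then p.+1 else if h == p.+1 then p else h.

(* Number and direction of the strand on leaving a slice that is entered on   *)
(* strand h in direction d.                                                   *)
Definition through (x : slice) (h : nat) (d : bool) : nat * bool :=
  let: (k, p) := x in
  match k, d with
  | X _, _ => (swap p h, d)
  | Cup, true | Cap, false => (if h < p then h else h.+2, d)
  | Cup, false | Cap, true =>
      if p <= h <= p.+1 then (swap p h, ~~ d)
      else (if h < p then h else h - 2, d)
  end.

Definition next_state (D : diagram) (a : state) : state :=
  let: (t, h, d) := a in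
  let: (h', d') := through (next_slice D a) h d in
  (if d' != d then t else if d then t.+1 else t.-1, h', d').

(* Some true (resp. Some false) if the step from a to next_state D a passes    *)
(* over (resp. under) a crossing, None if it does not go through a crossing.  *)
(* The slope of the strand followed is +1 iff (h == p) == d.                  *)
Definition passage (D : diagram) (a : state) : option bool :=
  let: (_, h, d) := a in
  let: (k, p) := next_slice D a in
  if k is X s then
    if (h == p) || (h == p.+1) then Some (s == ((h == p) == d)) else None
  else None.

(* A closed diagram with exactly one component.                               *)
Definition knot_diagram (D : diagram) : Prop :=
  [/\ tangle 0 D 0, 0 < size D
    & forall a b : state, on_diagram D a -> on_diagram D b ->
        exists n, (iter n (next_state D) a).1 = b.1].

(* Any two crossing passages that are consecutive along the diagram are one   *)
(* over and one under.                                                        *)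
Definition alternating (D : diagram) : Prop :=
  forall (a : state) (n : nat) (o o' : bool),
    on_diagram D a -> 0 < n ->
    passage D a = Some o ->
    (forall m, 0 < m < n -> passage D (iter m (next_state D) a) = None) ->
    passage D (iter n (next_state D) a) = Some o' ->
    o' = ~~ o.

(* ** Equivalence of diagrams                                                 *)
(* Planar isotopy and Reidemeister moves for sliced unoriented diagrams (the  *)
(* Turaev / Freyd-Yetter moves): Commute, ZigzagL, ZigzagR generate, with     *)
(* CapSlide and CupSlide (a crossing is moved past an extremum of one of its  *)
(* two strands), the planar isotopies.                                        *)
Inductive local_move : diagram -> diagram -> Prop :=
| Commute a b i k :
    local_move [:: (a, i); (b, i + outs a + k)] [:: (b, i + ins a + k); (a, i)]
| ZigzagL i : local_move [:: (Cup, i); (Cap, i.+1)] [::]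
| ZigzagR i : local_move [:: (Cup, i.+1); (Cap, i)] [::]
| CapSlide s i :
    local_move [:: (X s, i); (Cap, i.+1)] [:: (X (~~ s), i.+1); (Cap, i)]
| CupSlide s i :
    local_move [:: (Cup, i.+1); (X s, i)] [:: (Cup, i); (X (~~ s), i.+1)]
| Reidemeister1Cap s i : local_move [:: (X s, i); (Cap, i)] [:: (Cap, i)]
| Reidemeister1Cup s i : local_move [:: (Cup, i); (X s, i)] [:: (Cup, i)]
| Reidemeister2 s i : local_move [:: (X s, i); (X (~~ s), i)] [::]
(* The side condition excludes the two sign patterns for which the three      *)
(* strands are cyclically above one another.                                  *)
| Reidemeister3 s1 s2 s3 i of (s1 == s2) || (s2 == s3) :
    local_move [:: (X s1, i); (X s2, i.+1); (X s3, i)]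
               [:: (X s3, i.+1); (X s2, i); (X s1, i.+1)].

(* Both diagrams have to be well formed: this is what makes the strands       *)
(* involved in the empty side of a move exist.                                *)
Definition move (D D' : diagram) : Prop :=
  [/\ tangle 0 D 0, tangle 0 D' 0
    & exists u v L L', [/\ local_move L L', D = u ++ L ++ v & D' = u ++ L' ++ v]].

Definition same_knot (D D' : diagram) : Prop :=
  [/\ knot_diagram D, knot_diagram D' & clos_refl_sym_trans diagram move D D'].

(* ** Diagrams of 3-strand braid words                                        *)
(* The letter (i, s) stands for sigma_i^s with i = 1, 2.  The braid strand at *)
(* height i = 1, 2, 3 is the strand number i-1 of the long diagram.           *)
Definition braid_word := seq (nat * sign).

Definition long_diagram (b : braid_word) : diagram :=
  (Cup, 1) :: [seq (X l.2, l.1.-1) | l <- b]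
           ++ [:: (Cap, if odd (size b) then 1 else 0)].

(* ** Reduced billiard table words                                            *)
Definition reduced_word (c : nat) (w : seq sign) : Prop :=
  exists eps : seq nat,
    [/\ size eps = c /\ (forall i, i < c -> nth 0 eps i \in [:: 1; 2]),
        nth 0 eps 0 = 1, nth 0 eps c.-1 = 1,
        w = flatten [seq nseq (nth 0 eps i) (~~ odd i) | i <- iota 0 c]
      & size w = 1 %[mod 3]].

Definition billiard_braid (w : seq sign) : braid_word :=
  mkseq (fun j => (if odd j then 2 else 1, nth true w j)) (size w).

Definition billiard_diagram (w : seq sign) : diagram :=
  long_diagram (billiard_braid w).

(* ** Conversion of the runs                                                  *)
Definition run_decomposition (w : seq sign) (rs : seq (sign * nat)) : Prop :=
  [/\ all (fun r => 0 < r.2) rs, sorted (fun r r' => r.1 != r'.1) rs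
    & w = flatten [seq nseq r.2 r.1 | r <- rs]].

Definition run_letter (r : sign * nat) : option (nat * sign) :=
  match r with
  | (true, 1) => Some (1, true)
  | (true, 2) => Some (2, false)
  | (false, 1) => Some (2, false)
  | (false, 2) => Some (1, true)
  | _ => None
  end.

Definition run_conversion (w : seq sign) (D : diagram) : Prop :=
  exists (rs : seq (sign * nat)) (b : braid_word),
    [/\ run_decomposition w rs, map run_letter rs = map Some b
      & D = long_diagram b].

(* The long diagrams D and D' have the same knot when closed up, and D' does not  *)
(* have more crossings than D.                                                *)
Definition simplifies_to (D D' : diagram) : Prop :=
  same_knot (close_up D) (close_up D') /\ crossings D' <= crossings D.

(* Main.v *)
From Stdlib Require Import Relation_Operators.
Require Import Defs.

Set Implicit Arguments.
Unset Strict Implicit.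
Unset Printing Implicit Defensive.

(** The conversion rule is what remains of the braid of [w] once the half twists
    h = s1 s2 s1 = s2 s1 s2 are moved out of the way.  The letters of the billiard
    braid use s1 and s2 in turn, so a run of length 2 is one of
    s1 s2 = s2^-1 h and s2 s1 = s1^-1 h, or one of the mirror images of these
    with h^-1.  Moving h to the right exchanges s1 and s2 in everything that
    follows.  A run of length 1 flips the parity of the position and creates no
    half twist; a run of length 2 keeps the parity and creates one.  In both
    cases the generator that effectively comes next is exchanged, so that every
    + run effectively starts with s1 and every - run with s2.  Hence + becomes
    s1, ++ becomes s1 s2 = s2^-1 h, - becomes s2^-1 and -- becomes
    s2^-1 s1^-1 = s1 h^-1.  At the right end each half twist is absorbed: the
    kink of the two strands that the cap joins is undone, and the third strand
    slides across the cap, which thereby moves to the other pair of strands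
    ([half_twist_absorb]).  [runs_plat_eq] carries this out by induction on
    the runs, from right to left, with a boolean recording whether s1 and s2
    are currently exchanged.

    Both diagrams have to be knots.  A three-strand plat has one component as
    soon as the strand that starts at the left end is not the one that stops at
    the right end ([plat_knot]), and each of the moves used preserves this
    condition ([plat_eq_strand]); so it is enough to check it on the billiard
    braid.  There the strand moves with period 6 between the three heights, and
    after 1 mod 3 crossings it is in the middle, never at an end
    ([billiard_strand]).

    The converted word only uses s1 and s2^-1.  In the closed diagram s1 sits at
    the odd height 1 and s2^-1 at the even height 2, so the sign of a crossing is
    the parity of its height.  In such a diagram the parity of the height of a
    traveller, compared with the direction of travel, tells whether the next
    crossing is passed over or under; extrema preserve this comparison and
    crossings reverse it ([parity_step]), which gives alternation. *)

(** * Alternation from the parity of heights *)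

(** In a diagram where the sign of each crossing is the parity of its height,
    this predicts whether the next crossing on the way is passed over. *)
Definition expected_passage (a : state) : bool :=
  let: (_, h, d) := a in odd h == d.

Definition parity_signed (D : diagram) : bool :=
  all (fun x : slice => if x.1 is X s then s == odd x.2 else true) D.

Lemma odd_swap p h : odd (swap p h) = odd h (+) ((h == p) || (h == p.+1)).
Proof.
rewrite /swap; case: eqP => [->|_] /=; first by rewrite addbT.
by case: eqP => [->|_] /=; rewrite ?addbT ?negbK ?addbF.
Qed.

Lemma odd_swap_at p h : p <= h <= p.+1 -> odd (swap p h) = ~~ odd h.
Proof.
rewrite odd_swap => /andP[hp]; rewrite leq_eqVlt ltnS orbC => hle.
suff -> : (h == p) || (h == p.+1) by rewrite addbT.
by rewrite eqn_leq hp andbT.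
Qed.

Lemma odd_close_gap p h :
  (p <= h <= p.+1) = false -> odd (if h < p then h else h - 2) = odd h.
Proof.
case: ltnP => //= hp /negbT; rewrite -ltnNge => hlt.
by rewrite oddB ?addbF //; apply: leq_ltn_trans hlt.
Qed.

(** An extremum where the travel turns back changes both the parity of the
    height and the direction; an extremum of other strands shifts the height by
    0 or 2.  A crossing changes the parity of the heights of its two strands and
    keeps the direction. *)
Lemma parity_step (D : diagram) a : parity_signed D ->
  if passage D a is Some o
  then expected_passage a = o /\ expected_passage (next_state D a) = ~~ o
  else expected_passage (next_state D a) = expected_passage a.
Proof.
case: a => [[t h] d] hD; rewrite /passage /next_state.
set x := next_slice D (t, h, d).
have hx : (if x.1 is X s then s == odd x.2 else true) : bool.
  rewrite /x /next_slice; set i := if d then _ else _.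
  have [hi|hi] := ltnP i (size D); last by rewrite nth_default.
  exact: (all_nthP (Cup, 0) hD).
case: x hx => [[s||] p] /=.
- move/eqP=> ->; rewrite odd_swap.
  case: (h =P p) => [->|_] /=; first by case: d (odd p) => [] [].
  case: (h =P p.+1) => [->|_] /=; last by rewrite addbF.
  by case: d (odd p) => [] [].
- move=> _; case: d; first by case: ifP => _ /=; rewrite ?negbK.
  case: ifP => [/odd_swap_at /= -> | /odd_close_gap /= ->] //.
  by case: (odd h).
- move=> _; case: d; last by case: ifP => _ /=; rewrite ?negbK.
  case: ifP => [/odd_swap_at /= -> | /odd_close_gap /= ->] //.
  by case: (odd h).
Qed.

Lemma parity_signed_alternating D : parity_signed D -> alternating D.
Proof.
move=> hD a n o o' _ n0 ha hnone hn.
have := parity_step a hD; rewrite ha => -[_ h1].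
suff hm m : 0 < m <= n -> expected_passage (iter m (next_state D) a) = ~~ o.
  have := parity_step (iter n (next_state D) a) hD.
  by rewrite hn hm ?n0 ?leqnn // => -[].
elim: m => [//|[//|m] IH] /andP[_ hmn].
have := parity_step (iter m.+1 (next_state D) a) hD.
by rewrite hnone ?hmn // iterS => ->; apply: IH; apply: ltnW.
Qed.

(** * Three-strand plats and their moves *)

(** [(i, s)] stands for the braid generator of index 1 or 2, according to whether
    [i] is false or true, with exponent [s]: exchanging the two generators is
    negating [i]. *)
Definition letter := (bool * sign)%type.
(** The boolean tells which two of the three strands the right cap joins: the lower
    two if false, the upper two if true. *)
Definition plat := (seq letter * bool)%type.

Definition crossing_slices (u : seq letter) : diagram :=
  [seq (X l.2, (nat_of_bool l.1).+1) | l <- u].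

(** The closing arc is the strand at height 0, which puts the three braid
    strands at heights 1, 2, 3; the left cap is the cup at height 2. *)
Definition plat_diagram (T : plat) : diagram :=
  [:: (Cup, 0), (Cup, 2) & crossing_slices T.1
                           ++ [:: (Cap, (nat_of_bool T.2).+1); (Cap, 0)]].

(** Every rule leaves an arbitrary prefix [u] alone, so that plats can be
    simplified from the right.  Kinks and slides occur next to the cap, where
    two strands are joined.  The braid relation for equal signs yields the mixed
    ones by cancellation. *)
Inductive plat_step : plat -> plat -> Prop :=
| PlatR1 u i s : plat_step (u ++ [:: (i, s)], i) (u, i)
| PlatR2 u v i s c : plat_step (u ++ [:: (i, s), (i, ~~ s) & v], c) (u ++ v, c)
| PlatR3 u v s c :
    plat_step (u ++ [:: (false, s), (true, s), (false, s) & v], c)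
              (u ++ [:: (true, s), (false, s), (true, s) & v], c)
| PlatSlide u s :
    plat_step (u ++ [:: (false, s)], true) (u ++ [:: (true, ~~ s)], false).

Definition plat_eq := clos_refl_sym_trans plat plat_step.

Lemma plat_eq_trans T2 T1 T3 : plat_eq T1 T2 -> plat_eq T2 T3 -> plat_eq T1 T3.
Proof. exact: rst_trans. Qed.

Lemma plat_eq_sym T1 T2 : plat_eq T1 T2 -> plat_eq T2 T1.
Proof. exact: rst_sym. Qed.

(** Plats are compared as right-hand parts of a longer plat: this is the
    congruence that makes inductions from right to left possible. *)
Lemma plat_eq_cat u T T' :
  plat_eq T T' -> plat_eq (u ++ T.1, T.2) (u ++ T'.1, T'.2).
Proof.
elim=> {T T'} [T T' []|T|T T' _|T1 T2 T3 _ IH1 _ IH2] *; rewrite /= ?catA.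
- exact/rst_step/PlatR1.
- exact/rst_step/PlatR2.
- exact/rst_step/PlatR3.
- exact/rst_step/PlatSlide.
- exact: rst_refl.
- exact: rst_sym.
- exact: plat_eq_trans IH1 IH2.
Qed.

Lemma tangle_plat T : tangle 0 (plat_diagram T) 0.
Proof. by case: T => u []; elim: u => [|[[] s] u IH]. Qed.

Lemma plat_eq_moves T T' :
  plat_eq T T' ->
  clos_refl_sym_trans diagram move (plat_diagram T) (plat_diagram T').
Proof.
elim=> {T T'} [T T' h|T|T T' _ IH|T1 T2 T3 _ IH1 _ IH2];
  [|exact: rst_refl|exact: rst_sym|exact: rst_trans IH1 IH2].
apply: rst_step; split; try exact: tangle_plat.
case: h => [u i s|u v i s c|u v s c|u s];
  rewrite /plat_diagram /crossing_slices /= ?map_cat /= -?catA /=;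
  exists [:: (Cup, 0), (Cup, 2) & crossing_slices u].
- exists [:: (Cap, 0)]; do 2!eexists; split;
    [exact: (Reidemeister1Cap s i.+1) | by [] | by []].
- exists (crossing_slices v ++ [:: (Cap, (nat_of_bool c).+1); (Cap, 0)]).
  by do 2!eexists; split; [exact: (Reidemeister2 s i.+1) | by [] | by []].
- have same : (s == s) || (s == s) by rewrite eqxx.
  exists (crossing_slices v ++ [:: (Cap, (nat_of_bool c).+1); (Cap, 0)]).
  do 2!eexists; split; [exact: (Reidemeister3 1 same) | by [] | by []].
- exists [:: (Cap, 0)]; do 2!eexists; split; [exact: (CapSlide s 1) | by [] | by []].
Qed.

(** * Absorbing half twists into the cap *)

Definition turn (b : bool) (T : plat) : plat :=
  ([seq (l.1 (+) b, l.2) | l <- T.1], T.2 (+) b).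

Definition half_twist (i : bool) (s : sign) : seq letter :=
  [:: (i, s); (~~ i, s); (i, s)].

Lemma turnD b b' T : turn b (turn b' T) = turn (b' (+) b) T.
Proof.
case: T => u c; rewrite /turn /= -map_comp addbA; congr pair.
by apply: eq_map => l /=; rewrite addbA.
Qed.

Lemma plat_braid u v i s c :
  plat_eq (u ++ half_twist i s ++ v, c) (u ++ half_twist (~~ i) s ++ v, c).
Proof.
by case: i; [apply: rst_sym|]; apply: rst_step; apply: PlatR3.
Qed.

Lemma plat_cancel u v i s c :
  plat_eq (u ++ [:: (i, s), (i, ~~ s) & v], c) (u ++ v, c).
Proof. exact/rst_step/PlatR2. Qed.

(** For [r = s] this is the braid relation; for [r = ~~ s] it follows by
    inserting a cancelling pair and using the case of equal signs backwards. *)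
Lemma half_twist_pass u v i s j r c :
  plat_eq (u ++ half_twist i s ++ (j, r) :: v, c)
          (u ++ (~~ j, r) :: half_twist i s ++ v, c).
Proof.
have same k v' c' : plat_eq (half_twist i s ++ (k, s) :: v', c')
                            ((~~ k, s) :: half_twist i s ++ v', c').
  have [->|->] : i = ~~ k \/ i = k by case: i k => [] []; [right|left|left|right].
    by have := plat_braid [:: (~~ k, s)] v' k s c'; rewrite /half_twist /= negbK.
  apply: plat_eq_trans (plat_braid [::] _ _ _ _) _.
  rewrite /half_twist /= negbK.
  exact: rst_refl.
apply: (plat_eq_cat u (T := (_, c)) (T' := (_, c))).
have [->|->] : r = s \/ r = ~~ s by case: (r) (s) => [] []; [left|right|right|left].
  exact: same.
set ht := half_twist i s ++ (j, ~~ s) :: v.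
apply: plat_eq_trans
  (plat_eq_sym (plat_cancel [::] ht (~~ j) (~~ s) c)) _.
rewrite cat0s negbK.
apply: (plat_eq_cat [:: (~~ j, ~~ s)] (T := (_, c)) (T' := (_, c))).
apply: plat_eq_trans (plat_eq_sym (same j _ c)) _.
exact: plat_cancel.
Qed.

(** The half twist first passes through all letters, exchanging them.  Next to the
    cap it is written so that its last letter is a kink of the cap.  Once this
    kink is removed, the second letter slides across the cap and cancels the
    first. *)
Lemma half_twist_absorb i s (T : plat) :
  plat_eq (half_twist i s ++ T.1, T.2) (turn true T).
Proof.
case: T => u c; elim: u => [|[j r] u IH] /=; last first.
  apply: plat_eq_trans (half_twist_pass [::] u i s j r c) _.
  rewrite /turn /= addbT.
  exact: (plat_eq_cat [:: (~~ j, r)] IH).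
apply: plat_eq_trans (_ : plat_eq (half_twist c s, c) _).
  have [->|->] : i = c \/ i = ~~ c by case: i c => [] []; [left|right|right|left].
    exact: rst_refl.
  by have := plat_braid [::] [::] (~~ c) s c; rewrite /= !negbK.
apply: plat_eq_trans (_ : plat_eq ([:: (c, s); (~~ c, s)], c) _).
  exact/rst_step/(PlatR1 [:: (c, s); (~~ c, s)]).
apply: plat_eq_trans (_ : plat_eq ([:: (c, s); (c, ~~ s)], ~~ c) _).
  case: c => /=; first exact/rst_step/(PlatSlide [:: (true, s)]).
  apply/plat_eq_sym/rst_step.
  by have := PlatSlide [:: (false, s)] (~~ s); rewrite negbK.
by rewrite /turn /= addbT; exact: (plat_cancel [::] [::]).
Qed.

(** * From runs to crossings *)

Fixpoint runs (s : sign) (eps : seq nat) : seq (sign * nat) :=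
  if eps is e :: eps' then (s, e) :: runs (~~ s) eps' else [::].

Definition run_word (rs : seq (sign * nat)) : seq sign :=
  flatten [seq nseq r.2 r.1 | r <- rs].

Fixpoint billiard_letters (i : bool) (w : seq sign) : seq letter :=
  if w is s :: w' then (i, s) :: billiard_letters (~~ i) w' else [::].

(** The converted letters are the two whose sign is opposite to their index;
    doubling a run turns one into the other. *)
Definition run_crossing (r : sign * nat) : letter :=
  let o := r.1 (+) (r.2 == 2) in (~~ o, o).

(** [b] records the parity of the half twists already moved in from the left,
    so [~~ s (+) b] is the index of the first generator actually present,
    whereas [~~ s] is the effective one: generator 1 for a + run and 2 for
    a - run.  A run of length 2 contributes [(~~ i, s) (i, s)], which is
    [(i, ~~ s)] followed by a half twist; absorbing the latter changes [b] for
    the rest of the word. *)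
Lemma runs_plat_eq (eps : seq nat) (s b : bool) :
  all (mem [:: 1; 2]) eps ->
  let w := run_word (runs s eps) in
  plat_eq (billiard_letters (~~ s (+) b) w, ~~ s (+) b (+) odd (size w))
          (turn b ([seq run_crossing r | r <- runs s eps],
                   ~~ s (+) odd (size eps))).
Proof.
elim: eps s b => [|e eps IH] s b.
  by move=> _; rewrite /turn /= !addbF; apply: rst_refl.
rewrite /= !inE => /andP[/orP[] /eqP-> {}/IH IH].
  have := plat_eq_cat [:: (~~ s (+) b, s)] (IH (~~ s) b).
  rewrite /turn /run_crossing /run_word /=; set W := flatten _.
  by case: (s) (b) @W => [] [] W; rewrite /= ?(addbT, addbF) ?negbK.
set T := ([seq run_crossing r | r <- runs (~~ s) eps], ~~ ~~ s (+) odd (size eps)).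
set t := turn (~~ b) T; set i := s (+) b.
(* The second letter restores the parity, so the rest is exchanged once more. *)
apply: plat_eq_trans (_ : plat_eq ((~~ i, s) :: (i, s) :: t.1, t.2) _).
  have := plat_eq_cat [:: (~~ i, s); (i, s)] (IH (~~ s) (~~ b)).
  rewrite -/T -/t /i /= /run_word /=; set W := flatten _.
  by case: (s) (b) @W => [] [] W; rewrite /= ?(addbT, addbF) ?negbK.
apply: plat_eq_trans (_ : plat_eq ((i, ~~ s) :: half_twist i s ++ t.1, t.2) _).
  apply: plat_eq_sym.
  have := plat_cancel [::] ((~~ i, s) :: (i, s) :: t.1) i (~~ s) t.2.
  by rewrite negbK.
apply: plat_eq_trans (plat_eq_cat [:: (i, ~~ s)] (half_twist_absorb i s t)) _.
rewrite turnD addbT negbK /T /turn /run_crossing /= /i.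
by case: (s) (b) => [] []; rewrite /= ?(addbT, addbF) ?negbK; apply: rst_refl.
Qed.

(** * Plats with one component *)

Definition strand_at (u : seq letter) (h : nat) : nat :=
  foldl (fun h l => swap (nat_of_bool l.1).+1 h) h u.

Definition end_height (c : bool) : nat := if c then 1 else 3.

(** The moves next to the cap change the permutation of the braid, but only in
    ways that the position of the cap makes up for: a kink permutes the two
    strands that the cap joins, and a slide moves the right end together with
    its strand. *)
Lemma plat_eq_strand T T' h : plat_eq T T' ->
  (strand_at T.1 h == end_height T.2) = (strand_at T'.1 h == end_height T'.2).
Proof.
elim=> {T T'} [T T' []|//|T T' _ -> //|T1 T2 T3 _ -> _ ->//]
  => [u i s|u v i s c|u v s c|u s].
- rewrite /strand_at foldl_cat /=; move: (foldl _ _ _) => {}h.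
  by case: i; move: h => [|[|[|[|h]]]].
- rewrite /strand_at !foldl_cat /=; congr (foldl _ _ _ == _).
  by move: (foldl _ _ _) => {}h; case: i; move: h => [|[|[|[|h]]]].
- rewrite /strand_at !foldl_cat /=; congr (foldl _ _ _ == _).
  by move: (foldl _ _ _) => {}h; move: h => [|[|[|[|h]]]].
- rewrite /strand_at !foldl_cat /=; move: (foldl _ _ _) => {}h.
  by move: h => [|[|[|[|h]]]].
Qed.

(** Three consecutive letters form a half twist up to signs; it carries a strand
    from one extreme height to the other, and the next letter has the other
    index.  One further letter takes the strand to the middle. *)
Lemma billiard_strand m i w : size w = 3 * m + 1 ->
  strand_at (billiard_letters i w) (if i then 3 else 1) = 2.
Proof.
elim: m i w => [|m IH] i w; first by case: w i => [|s [|]] // [].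
rewrite mulnS -addnA addnC addn3.
case: w => [|s1 [|s2 [|s3 w]]] //= [/IH]-/(_ (~~ i)).
by rewrite negbK; case: i.
Qed.

Lemma swapK p : involutive (swap p).
Proof.
move=> h; rewrite /swap; case: (h =P p) => [->|hp].
  by rewrite eqxx; case: eqP => // /eqP; rewrite eqn_leq ltnn.
case: (h =P p.+1) => [->|hp']; first by rewrite eqxx.
by case: eqP => //; case: eqP.
Qed.

Lemma strand_at_perm u :
  strand_at u 0 = 0 /\
  (strand_at u 1, strand_at u 2, strand_at u 3) \in
    [:: (1, 2, 3); (1, 3, 2); (2, 1, 3); (2, 3, 1); (3, 1, 2); (3, 2, 1)].
Proof.
elim/last_ind: u => [//|u l [e0 IH]].
rewrite /strand_at -cats1 !foldl_cat -!/(strand_at u _) /= e0.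
split; first by case: (l.1).
move: IH; rewrite !inE !xpair_eqE.
by case/or4P=> [|||/or3P[]] /andP[/andP[/eqP-> /eqP->] /eqP->]; case: (l.1).
Qed.

Lemma strands_atS (E : diagram) t : t < size E ->
  strands_at E t.+1 = strands_at E t - ins (nth (Cup, 0) E t).1
                      + outs (nth (Cup, 0) E t).1.
Proof.
by move=> ht; rewrite /strands_at (take_nth (Cup, 0)) // -cats1 foldl_cat.
Qed.

Lemma next_right (E : diagram) t h :
  next_state E (t, h, true) =
    let: (h', d) := through (nth (Cup, 0) E t) h true in
    (if d then t.+1 else t, h', d).
Proof. by rewrite /next_state /next_slice; case: through => h' []. Qed.

Lemma next_left (E : diagram) t h :
  next_state E (t.+1, h, false) =
    let: (h', d) := through (nth (Cup, 0) E t) h false in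
    (if d then t.+1 else t, h', d).
Proof. by rewrite /next_state /next_slice /=; case: through => h' []. Qed.

(** A traveller sweeps along a strand of the braid from one side to the other, is
    sent to the partner of that strand by the cups or caps there, and sweeps
    back.  The left side pairs the four strands (the closing arc included) as
    01|23.  If the strand [a] that stops at the right end is 2 or 3, the right
    side pairs them, in terms of their left heights, as 0a|1(5-a), and
    alternating the two pairings runs through all four strands. *)
Section Tour.
Variables (w : seq letter) (c : bool).
Let D := plat_diagram (w, c).
Let n := size w.
Let pos j h := strand_at (take j w) h.

Lemma nth_crossing j : j < n ->
  exists s, nth (Cup, 0) D j.+2 = (X s, (nat_of_bool (nth (false, true) w j).1).+1).
Proof.
move=> hj; exists (nth (false, true) w j).2.
by rewrite /D /= nth_cat size_map -/n hj (nth_map (false, true)).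
Qed.

Lemma nth_cap : nth (Cup, 0) D n.+2 = (Cap, c.+1).
Proof. by rewrite /D /= nth_cat size_map ltnn subnn. Qed.

Lemma nth_closure : nth (Cup, 0) D n.+3 = (Cap, 0).
Proof. by rewrite /D /= nth_cat size_map ltnNge leqnSn subSnn. Qed.

Lemma size_plat : size D = n.+4.
Proof. by rewrite /D /= size_cat size_map /= addn2. Qed.

Lemma strands_at_crossings j : j <= n -> strands_at D j.+2 = 4.
Proof.
rewrite /strands_at /D /= => hj; rewrite take_cat size_map -/n.
have -> : (if j < n then take j (crossing_slices w)
  else crossing_slices w ++ take (j - n) [:: (Cap, c.+1); (Cap, 0)])
  = crossing_slices (take j w).
  rewrite /crossing_slices map_take; case: ltnP => // nj.
  have -> : j = n by apply/eqP; rewrite eqn_leq hj.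
  by rewrite subnn take0 cats0 take_oversize // size_map.
by elim: (take j w).
Qed.

Lemma strands_at_closure : strands_at D n.+3 = 2.
Proof.
by rewrite strands_atS ?size_plat // strands_at_crossings // nth_cap.
Qed.

Lemma strands_at_end : strands_at D n.+4 = 0.
Proof.
by rewrite strands_atS ?size_plat // strands_at_closure nth_closure.
Qed.

Lemma posS j h : j < n ->
  pos j.+1 h = swap (nat_of_bool (nth (false, true) w j).1).+1 (pos j h).
Proof.
by move=> hj; rewrite /pos (take_nth (false, true)) // /strand_at -cats1 foldl_cat.
Qed.

Lemma sweep_right j h : j <= n ->
  iter j (next_state D) (2, h, true) = (j.+2, pos j h, true).
Proof.
elim: j => [_|j IH hj]; first by rewrite /pos take0.
rewrite iterS IH ?(ltnW hj) // next_right.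
by have [s ->] := nth_crossing hj; rewrite /= posS.
Qed.

Lemma sweep_left j h : j <= n ->
  iter j (next_state D) (n.+2, pos n h, false) = ((n - j).+2, pos (n - j) h, false).
Proof.
elim: j => [_|j IH hj]; first by rewrite subn0.
have hj' : n - j.+1 < n by rewrite ltn_subrL (leq_ltn_trans _ hj).
have e : n - j = (n - j.+1).+1 by rewrite subnSK.
rewrite iterS IH ?(ltnW hj) // e posS // next_left.
by have [s ->] := nth_crossing hj'; rewrite /= swapK.
Qed.

Lemma pos_lt j h : h < 4 -> pos j h < 4.
Proof.
have [e0] := strand_at_perm (take j w); rewrite -!/(pos _ _) in e0 *.
rewrite !inE !xpair_eqE.
case/or4P=> [|||/or3P[]] /andP[/andP[/eqP e1 /eqP e2] /eqP e3];
by case: h => [|[|[|[|]]]] // _; rewrite ?e0 ?e1 ?e2 ?e3.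
Qed.

Lemma pos_surj j h : h < 4 -> exists2 h0, h0 < 4 & pos j h0 = h.
Proof.
have [e0 hp] := strand_at_perm (take j w); rewrite -!/(pos _ _) in e0 hp.
have [f3 [f2 f1]] : (exists2 h0, h0 < 4 & pos j h0 = 3) /\
  (exists2 h0, h0 < 4 & pos j h0 = 2) /\ (exists2 h0, h0 < 4 & pos j h0 = 1).
  move: hp; rewrite !inE !xpair_eqE.
  by case/or4P=> [|||/or3P[]] /andP[/andP[/eqP e1 /eqP e2] /eqP e3];
    (split; [|split]);
    (by exists 1) || (by exists 2) || (by exists 3).
by case: h => [|[|[|[|h]]]] // _; exists 0.
Qed.

Definition reaches (a b : state) : Prop := exists k, iter k (next_state D) a = b.
Definition visits (a : state) (P : nat * nat) : Prop :=
  exists k, (iter k (next_state D) a).1 = P.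

Lemma reaches_trans b a a' : reaches a b -> reaches b a' -> reaches a a'.
Proof. by move=> [k <-] [k' <-]; exists (k' + k); rewrite iterD. Qed.

Lemma reaches_visits b a P : reaches a b -> visits b P -> visits a P.
Proof. by move=> [k <-] [k' <-]; exists (k' + k); rewrite iterD. Qed.

Lemma reaches_iter k a b : iter k (next_state D) a = b -> reaches a b.
Proof. by exists k. Qed.

(** The start of a sweep of strand [x.1], rightwards if [x.2] holds; strands are
    named after their heights on the left side. *)
Definition departure (x : nat * bool) : state :=
  if x.2 then (2, x.1, true) else (n.+2, pos n x.1, false).

Definition left_partner (h : nat) : nat := nth 0 [:: 1; 0; 3; 2] h.

(** The end height is paired with the closing arc 0 through the final cap. *)
Definition cap_partner (h : nat) : nat :=
  nth 0 (if c then [:: 1; 0; 3; 2] else [:: 3; 2; 1; 0]) h.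

Lemma left_turn h : h < 4 -> reaches (2, h, false) (2, left_partner h, true).
Proof.
by case: h => [|[|[|[|h]]]] // _; [exists 3|exists 3|exists 1|exists 1].
Qed.

Lemma next_cap_left h :
  next_state D (n.+3, h, false) = (n.+2, if h < c.+1 then h else h.+2, false).
Proof. by rewrite next_left nth_cap. Qed.

Lemma next_cap_right h : next_state D (n.+2, h, true) =
  if c.+1 <= h <= c.+2 then (n.+2, swap c.+1 h, false)
  else (n.+3, if h < c.+1 then h else h - 2, true).
Proof. by rewrite next_right nth_cap /=; case: ifP. Qed.

Lemma next_closure h : h < 2 ->
  next_state D (n.+3, h, true) = (n.+3, 1 - h, false).
Proof. by rewrite next_right nth_closure; case: h => [|[|]]. Qed.

Lemma cap_turn h : h < 4 ->
  reaches (n.+2, h, true) (n.+2, cap_partner h, false).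
Proof.
rewrite /reaches /cap_partner => h4.
have [/andP[h1 h2]|hout] := boolP (c.+1 <= h <= c.+2).
  exists 1; rewrite iterS [iter 0 _ _]/= next_cap_right h1 h2.
  by move: h1 h2 h4; case: (c); case: h => [|[|[|[|]]]].
exists 3; rewrite !iterS [iter 0 _ _]/= next_cap_right (negbTE hout).
rewrite next_closure ?next_cap_left.
  by move: hout h4; case: (c); case: h => [|[|[|[|]]]].
by move: hout h4; case: (c); case: h => [|[|[|[|]]]].
Qed.

Hypothesis knotted : strand_at w 1 != end_height c.

(** The pairing on the right side transported to the left heights: [5 - a] is
    the element of 2, 3 other than [a]. *)
Definition end_partner (a h : nat) : nat :=
  if h == 0 then a else if h == a then 0 else if h == 1 then 5 - a else 1.

(** If [a] were 1, strand 1 and the closing arc would already close up to a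
    component of their own, which [knotted] excludes. *)
Lemma exists_end_strand : exists a,
  (a == 2) || (a == 3) /\
  forall h, h < 4 -> cap_partner (pos n h) = pos n (end_partner a h).
Proof.
have [e0 hp] := strand_at_perm w; move: knotted.
rewrite /pos /n take_size /cap_partner /end_height.
move: hp; rewrite !inE !xpair_eqE.
(* Each of the six permutations of the braid strands either violates [knotted]
   or determines [a]. *)
case/or4P=> [|||/or3P[]] /andP[/andP[/eqP e1 /eqP e2] /eqP e3];
  rewrite e1; case: (c) => // _;
  ((exists 2; split=> // -[|[|[|[|h]]]] // _; rewrite /= ?e0 ?e1 ?e2 ?e3; done)
   || (exists 3; split=> // -[|[|[|[|h]]]] // _; rewrite /= ?e0 ?e1 ?e2 ?e3; done)).
Qed.

Definition next_departure (a : nat) (x : nat * bool) : nat * bool :=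
  if x.2 then (end_partner a x.1, false) else (left_partner x.1, true).

Lemma departure_step a x : (a == 2) || (a == 3) ->
  (forall h, h < 4 -> cap_partner (pos n h) = pos n (end_partner a h)) ->
  x.1 < 4 ->
  (next_departure a x).1 < 4 /\
  reaches (departure x) (departure (next_departure a x)).
Proof.
case: x => h [] ha hcap h4; rewrite /next_departure /departure /=.
  split; first by move: ha h4 => /orP[] /eqP->; case: h => [|[|[|[|]]]].
  apply: reaches_trans (reaches_iter (sweep_right h (leqnn n))) _.
  by rewrite -hcap //; apply/cap_turn/pos_lt.
split; first by case: h h4 => [|[|[|[|]]]].
apply: reaches_trans (reaches_iter (sweep_left h (leqnn n))) _.
by rewrite subnn /pos take0; apply: left_turn.
Qed.

(** A tour closes up after four sweeps, so a condition met somewhere on every tour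
    can be checked by computation. *)
Definition on_all_tours (P : nat -> pred (nat * bool)) : bool :=
  all (fun a => all (fun x => has (P a) (traject (next_departure a) x 4))
                    [seq (h, d) | h <- iota 0 4, d <- [:: true; false]])
      [:: 2; 3].

Lemma departure_orbit P x : on_all_tours P -> x.1 < 4 ->
  exists a y, [/\ pos n a = end_height c, P a y
                 & reaches (departure x) (departure y)].
Proof.
have [a [ha hcap]] := exists_end_strand.
move=> hall hx; have ha' : a \in [:: 2; 3] by rewrite !inE.
have hx' : x \in [seq (h, d) | h <- iota 0 4, d <- [:: true; false]].
  by case: x hx => [[|[|[|[|]]]] []].
have /hasP[y /trajectP[k _ ->] Py] := allP (allP hall _ ha') _ hx'.
exists a, (iter k (next_departure a) x); split=> //.
  have [e0 _] := strand_at_perm (take n w).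
  have := hcap 0 isT; rewrite {1}/pos e0 /end_partner /= => <-.
  by rewrite /cap_partner; case: (c).
suff [] : (iter k (next_departure a) x).1 < 4 /\
  reaches (departure x) (departure (iter k (next_departure a) x)) by [].
elim: k {Py} => [|k [IH4 IH]]; first by split=> //; exists 0.
have [h4 hr] := departure_step ha hcap IH4.
by split=> //; apply: reaches_trans IH hr.
Qed.

Lemma departure_visits_strand x j : j <= n ->
  visits (departure x) (j.+2, pos j x.1).
Proof.
case: x => h [] hj; first by exists j; rewrite sweep_right.
by exists (n - j); rewrite /departure sweep_left ?leq_subr // subKn.
Qed.

Lemma iter1 (a : state) : iter 1 (next_state D) a = next_state D a.
Proof. by []. Qed.

Lemma iter2 (a : state) :
  iter 2 (next_state D) a = next_state D (next_state D a).
Proof. by []. Qed.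

(** The points on the four strands lie on a sweep; those next to the
    leftmost cup follow a leftward sweep of strand 0 or 1, and those next to
    the rightmost cap follow a rightward sweep of strand 0 or [a]. *)
Lemma departure_visits x b : x.1 < 4 -> on_diagram D b -> visits (departure x) b.1.
Proof.
case: b => [[t h] d] hx; rewrite /on_diagram size_plat => /andP[ht hh].
case: t ht hh => [|[|t]] // ht hh.
  have /departure_orbit/(_ hx)[_ [y [_ hy /reaches_visits]]] :
    on_all_tours (fun _ => mem [:: (0, false); (1, false)]) by [].
  apply; apply: (reaches_visits (b := (2, y.1, false))).
    move: hy; rewrite !inE => /orP[] /eqP->;
    by apply: reaches_trans (reaches_iter (sweep_left _ (leqnn n))) _;
      rewrite subnn /pos take0; exists 0.
  move: hy; rewrite !inE => /orP[] /eqP->; case: h hh => [|[|]] // _;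
  by [exists 1 | exists 2].
move: ht hh; rewrite !ltnS leq_eqVlt => /orP[/eqP->|].
  by rewrite strands_at_end.
rewrite ltnS leq_eqVlt => /orP[/eqP->|]; last first.
  move=> ht; rewrite strands_at_crossings // => /(pos_surj t)[h0 h4 <-].
  have /departure_orbit/(_ hx)[_ [y [_ hy /reaches_visits]]] :
    on_all_tours (fun _ y => y.1 == h0) by case: h0 h4 => [|[|[|[|]]]].
  by apply; rewrite -(eqP hy); apply: departure_visits_strand.
rewrite strands_at_closure => hh.
have /departure_orbit/(_ hx)[a [y [ha hy /reaches_visits]]] :
  on_all_tours (fun a => mem [:: (0, true); (a, true)]) by [].
apply; have e0 : pos n 0 = 0 by have [] := strand_at_perm (take n w).
move: hy; rewrite !inE => /orP[] /eqP->; apply: reaches_visits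
  (reaches_iter (sweep_right _ (leqnn n))) _; rewrite ?e0 ?ha.
  have e : next_state D (n.+2, 0, true) = (n.+3, 0, true).
    by rewrite next_cap_right.
  case: h hh => [|[|]] // _; [exists 1 | exists 2];
  by rewrite ?iter2 ?iter1 e ?next_closure.
have e : next_state D (n.+2, end_height c, true) = (n.+3, 1, true).
  by rewrite next_cap_right /end_height; case: (c).
case: h hh => [|[|]] // _; [exists 2 | exists 1];
by rewrite ?iter2 ?iter1 e ?next_closure.
Qed.

Lemma reaches_departure b : on_diagram D b ->
  exists2 x, x.1 < 4 & reaches b (departure x).
Proof.
case: b => [[t h] d]; rewrite /on_diagram size_plat => /andP[ht hh].
case: t ht hh => [|[|t]] // ht hh.
  case: d; [exists (h, true) | exists (1 - h, true)].
  - by case: h hh => [|[|]].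
  - by case: h hh => [|[|]] // _; exists 1.
  - by case: h hh => [|[|]].
  - by case: h hh => [|[|]] // _; exists 2.
move: ht hh; rewrite !ltnS leq_eqVlt => /orP[/eqP->|].
  by rewrite strands_at_end.
rewrite ltnS leq_eqVlt => /orP[/eqP->|]; last first.
  move=> ht; rewrite strands_at_crossings // => /(pos_surj t)[h0 h4 <-].
  case: d.
    have c4 : cap_partner (pos n h0) < 4.
      by rewrite /cap_partner; case: (c); case: (pos n h0) => [|[|[|[|[|]]]]].
    have [y hy ey] := pos_surj n c4; exists (y, false) => //.
    apply: reaches_trans (_ : reaches _ (n.+2, pos n h0, true)) _.
      exists (n - t); rewrite -(sweep_right h0 ht) -iterD subnK //.
      exact: sweep_right.
    by rewrite /departure /= ey; apply: cap_turn; apply: pos_lt.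
  exists (left_partner h0, true).
    by case: h0 h4 => [|[|[|[|]]]].
  apply: reaches_trans (left_turn h4).
  exists t; have := sweep_left h0 (leq_subr t n); rewrite subKn // => <-.
  by rewrite -iterD subnKC // sweep_left // subnn /pos take0.
rewrite strands_at_closure => hh.
have hl h' : h' < 2 ->
    exists2 x, x.1 < 4 & reaches (n.+3, h', false) (departure x).
  move=> h2; have h4 : (if h' < c.+1 then h' else h'.+2) < 4.
    by case: ifP => _ //; apply: leq_trans h2 _.
  have [y hy ey] := pos_surj n h4; exists (y, false) => //.
  by exists 1; rewrite iter1 next_cap_left /departure /= ey.
case: d; last exact: hl.
have [|x hx hr] := hl (1 - h); first by case: h hh => [|[|]].
by exists x => //; apply: reaches_trans hr; exists 1; rewrite iter1 next_closure.
Qed.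

Lemma plat_knot : knot_diagram D.
Proof.
split=> [||a b ha hb]; [exact: tangle_plat | by rewrite size_plat |].
have [x hx hr] := reaches_departure ha.
exact: reaches_visits hr (departure_visits hx hb).
Qed.

End Tour.

(** * Run decompositions *)

(** The length of the first run is the position of the first opposite sign. *)
Lemma run_decomposition_uniq w rs rs' :
  run_decomposition w rs -> run_decomposition w rs' -> rs = rs'.
Proof.
elim: rs w rs' => [|[s k] rs IH] w [|[s' k'] rs']
  [/= pos1 alt1 ->] [/= pos2 alt2] //.
- by case: k' pos2 alt2.
- by case: k pos1 alt1.
have next_sign (q : sign) r : path (fun r r' => r.1 != r'.1) (q, 0) r ->
    all (fun r => 0 < r.2) r -> find (pred1 (~~ q)) (run_word r) = 0.
  case: r => [|[q' [|j]] r] //= /andP[hq _] _.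
  by rewrite (_ : q' == ~~ q) //; case: (q) (q') hq => [] [].
have len q j r : path (fun r r' => r.1 != r'.1) (q, j) r ->
    all (fun r => 0 < r.2) r ->
    find (pred1 (~~ q)) (nseq j q ++ run_word r) = j.
  move=> hr hp; rewrite find_cat has_nseq /= (_ : (q == ~~ q) = false) ?andbF.
    by rewrite size_nseq next_sign ?addn0 //; case: r hr {hp}.
  by case: q {hr}.
move: pos1 pos2 => /andP[k1 pos1] /andP[k2 pos2] heq.
have es : s = s'.
  by move: heq k1 k2; clear; case: k k' => [|?] [|?] //= [].
subst s'; have ek : k = k'.
  by rewrite -(len s k rs) // -(len s k' rs') //; congr find.
subst k'; congr cons; apply: (IH (run_word rs)).
  by split=> //; apply: path_sorted alt1.
split=> //; first exact: path_sorted alt2.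
by move/(congr1 (drop k)): heq; rewrite !drop_size_cat ?size_nseq.
Qed.

Lemma runs_decomposition eps s : all (mem [:: 1; 2]) eps ->
  run_decomposition (run_word (runs s eps)) (runs s eps).
Proof.
move=> heps; split=> //.
  elim: eps s heps => //= e eps IH s /andP[he /IH ->].
  by move: he; rewrite !inE => /orP[] /eqP->.
case: eps heps => //= e eps _; elim: eps s e => //= e' eps IH s e.
by rewrite IH; case: s.
Qed.

Lemma reduced_runs c w : reduced_word c w ->
  exists eps, [/\ size eps = c, all (mem [:: 1; 2]) eps
                & w = run_word (runs true eps)].
Proof.
move=> [eps [[<- heps] _ _ -> _]]; exists eps; split=> //.
  by apply/(all_nthP 0) => i hi; apply: heps.
rewrite /run_word; congr flatten.
suff gen s (f : nat -> sign) : (forall i, f i = odd i (+) s) ->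
    [seq nseq (nth 0 eps i) (f i) | i <- iota 0 (size eps)]
      = [seq nseq r.2 r.1 | r <- runs s eps].
  by apply: gen => i; rewrite addbT.
elim: eps s f {heps} => //= e eps IH s f hf; rewrite hf /=; congr cons.
rewrite (iotaDl 1 0) -map_comp; apply: (IH (~~ s)) => i.
by rewrite hf /= addbN addNb.
Qed.

(** * Sliced diagrams of braids as plats *)

Definition braid_of_letters (u : seq letter) : braid_word :=
  [seq ((nat_of_bool l.1).+1, l.2) | l <- u].

Lemma close_up_braid u :
  close_up (long_diagram (braid_of_letters u)) = plat_diagram (u, odd (size u)).
Proof.
rewrite /close_up /long_diagram /plat_diagram /braid_of_letters /crossing_slices.
rewrite size_map /= map_cat -!map_comp -catA /=.
by case: odd.
Qed.

Lemma billiard_braidE w :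
  billiard_braid w = braid_of_letters (billiard_letters false w).
Proof.
rewrite /billiard_braid /mkseq.
suff gen i (f : nat -> nat) : (forall j, f j = (nat_of_bool (odd j (+) i)).+1) ->
    [seq (f j, nth true w j) | j <- iota 0 (size w)]
      = braid_of_letters (billiard_letters i w).
  by apply: gen => j; rewrite addbF; case: odd.
elim: w i f => //= s w IH i f hf; rewrite hf /=; congr cons.
rewrite (iotaDl 1 0) -map_comp; apply: (IH (~~ i)) => j.
by rewrite hf /= addbN addNb.
Qed.

Lemma run_letter_crossing eps s : all (mem [:: 1; 2]) eps ->
  map run_letter (runs s eps)
    = map Some (braid_of_letters (map run_crossing (runs s eps))).
Proof.
elim: eps s => //= e eps IH s /andP[he /IH ->]; congr cons.
by move: he; rewrite !inE => /orP[] /eqP->; case: s.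
Qed.

Lemma size_runs s eps : size (runs s eps) = size eps.
Proof. by elim: eps s => //= e eps IH s; rewrite IH. Qed.

Lemma size_run_word s eps : all (mem [:: 1; 2]) eps ->
  size eps <= size (run_word (runs s eps)).
Proof.
elim: eps s => //= e eps IH s /andP[he /(IH (~~ s)) hs].
rewrite size_cat size_nseq -add1n leq_add //.
by move: he; rewrite !inE => /orP[] /eqP->.
Qed.

Lemma size_billiard_letters i w : size (billiard_letters i w) = size w.
Proof. by elim: w i => //= s w IH i; rewrite IH. Qed.

Lemma crossings_long b : crossings (long_diagram b) = size b.
Proof.
by rewrite /crossings /= count_cat /= addn0 addn0 count_map; elim: b => //= l b ->.
Qed.

Lemma plat_parity_signed u c :
  all (fun l : letter => l.2 == ~~ l.1) u -> parity_signed (plat_diagram (u, c)).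
Proof.
rewrite /parity_signed /= all_cat /= andbT all_map => h.
by apply: sub_all h => -[[] s] /=.
Qed.

Theorem theorem2p4 (c : nat) (w : seq sign) (hc : 3 <= c)
    (hw : reduced_word c w) :
  exists D : diagram,
    [/\ unique (run_conversion w) D,
        crossings D = c,
        simplifies_to (billiard_diagram w) D
      & alternating (close_up D)].
Proof.
have w_mod : size w = 1 %[mod 3] by case: hw => eps [].
have [eps [heps eps12 ew]] := reduced_runs hw.
set rs := runs true eps; set u := map run_crossing rs.
have size_u : size u = c by rewrite size_map size_runs.
have plat_w : plat_eq (billiard_letters false w, odd (size w)) (u, odd c).
  have := runs_plat_eq true false eps12.
  rewrite /= -ew /turn /= addbF heps (eq_map (g := id)) ?map_id //.
  by case=> i s; rewrite addbF.
have knot_w : strand_at (billiard_letters false w) 1 != end_height (odd (size w)).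
  rewrite (@billiard_strand (size w %/ 3) false); first by case: odd.
  by rewrite {1}(divn_eq (size w) 3) w_mod mulnC.
exists (long_diagram (braid_of_letters u)); split.
- split.
    exists rs, (braid_of_letters u); split=> //.
      by rewrite ew; apply: runs_decomposition.
    exact: run_letter_crossing.
  move=> D' [rs' [b [hrs' hb ->]]].
  have ers : rs = rs'.
    by apply: run_decomposition_uniq hrs'; rewrite ew; apply: runs_decomposition.
  congr long_diagram; apply: (inj_map (@Some_inj _)).
  by rewrite -hb -ers -run_letter_crossing.
- by rewrite crossings_long size_map.
- split.
    rewrite /billiard_diagram billiard_braidE !close_up_braid.
    rewrite size_billiard_letters size_u; split.
    + exact: plat_knot.
    + by apply: plat_knot; rewrite -(plat_eq_strand 1 plat_w).
    + exact: plat_eq_moves.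
  rewrite /billiard_diagram !crossings_long billiard_braidE !size_map.
  rewrite size_billiard_letters size_runs ew; exact: size_run_word.
rewrite close_up_braid; apply/parity_signed_alternating/plat_parity_signed.
by rewrite all_map; apply/allP => r _ /=; rewrite negbK.
Qed.
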